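(* Let $X$ be an affine variety over $\mathbb{C}$ and $k,r\ge1$. In the Euclidean topology, the underlying topological space of $\Delta^{k,r}(X)$ agrees with the family of weighted configuration spaces $\big(((\mathbb{C}^r)^k)^{\circ}\times X^k\big)/\sim$; that is, the defining map $((\mathbb{C}^r)^k)^{\circ}\times X^k\to\Delta^{k,r}(X)$ induces a homeomorphism $\big(((\mathbb{C}^r)^k)^{\circ}\times X^k\big)/\sim\ \to\Delta^{k,r}(X)$. Here $\sim$ is the relation $$(\overline{m_1},\ldots,\overline{m_k},x_1,\ldots,x_k)\sim(\overline{m_1},\ldots,\overline{m_k},x_1',\ldots,x_k')$$ if for each $x\in X$ we have $\sum_{i:\,x_i=x}\overline{m_i}=\sum_{i:\,x_i'=x}\overline{m_i}$.
   Context: For $\overline m\in\mathbb{C}^r$, $(\overline m)_j$ is its $j$-th coordinate. $((\mathbb{C}^r)^k)^{\circ}$ is the set of $(\overline{m_1},\ldots,\overline{m_k})\in(\mathbb{C}^r)^k$ with $\sum_{i\in S}\overline{m_i}\ne\overline0$ for every nonempty $S\subset\{1,\ldots,k\}$. Let $e_n(y_1,\ldots,y_k,x_1,\ldots,x_k)=\sum_{i_1+\cdots+i_k=n}\binom{y_1}{i_1}\cdots\binom{y_k}{i_k}x_1^{i_1}\cdots x_k^{i_k}$, with $\binom yi=y(y-1)\cdots(y-i+1)/i!$; for vectors $v_i\in V$ in place of the $x_i$, products are taken in $\mathrm{Sym}^nV$. Definition of $\Delta^{k,r}(X)$: choose a closed embedding of $X$ into a finite-dimensional vector space $V$ (viewed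 as an affine space). For $N$ sufficiently large the morphism $$((\mathbb{C}^r)^k)^{\circ}\times X^k\to((\mathbb{C}^r)^k)^{\circ}\times\Big(\prod_{i=1}^N\mathrm{Sym}^iV\Big)^r,$$ $$(\overline{m_1},\ldots,\overline{m_k},v_1,\ldots,v_k)\mapsto\big(\overline{m_1},\ldots,\overline{m_k},(e_i((\overline{m_1})_j,\ldots,(\overline{m_k})_j,v_1,\ldots,v_k))_{1\le i\le N,1\le j\le r}\big)$$ is finite, and its image (a closed subvariety, with reduced structure) is independent of $N$ up to the coordinate projections, which are isomorphisms. This image is $\Delta^{k,r}(X)$, a variety over $((\mathbb{C}^r)^k)^\circ$. *)

(* Defs.v *)
From HB Require Import structures.
(* The notations of mpoly clash with those of the analysis library. *)
From mathcomp Require mpoly.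
Import -(notations) mpoly.
From mathcomp Require Import all_boot all_order all_algebra generic_quotient.
From mathcomp Require Import complex.
From mathcomp Require Import all_classical all_reals all_analysis.
Set Implicit Arguments.
Unset Strict Implicit.
Unset Printing Implicit Defensive.
Import GRing.Theory Num.Theory.
Import numFieldNormedType.Exports.
Local Open Scope classical_set_scope.
Local Open Scope ring_scope.
Local Open Scope quotient_scope.

(* Packed as a numClosedFieldType, so that C R, and hence matrices over it,
   carry the topology of the complex modulus (the Euclidean topology). *)
Definition C (R : realType) : numClosedFieldType := R[i].

(* Zero loci of sets of polynomials: the images of affine varieties under
   closed embeddings in the affine space C^d. *)
Definition zariski_closed (R : realType) (d : nat) (X : set 'rV[C R]_d) :=
  exists I : set (mpoly d (C R)),
    X = [set v | forall p, I p -> meval (fun j => v 0 j) p = 0].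

(* The i-th weight of m : 'M_(k, r) is its i-th row. *)
Definition weights (R : realType) (k r : nat) : set 'M[C R]_(k, r) :=
  [set m | forall S : {set 'I_k}, S != finset.set0 ->
    \sum_(i in S) row i m != 0].
Arguments weights : clear implicits.

Section Dom.
Context (R : realType) (d k r : nat) (X : set 'rV[C R]_d).

Definition dom : Type := (weights R k r * {ptws 'I_k -> X})%type.
HB.instance Definition _ := Topological.on dom.

Definition sim_prop (u v : dom) : Prop :=
  u.1 = v.1 /\
  forall x : X,
    \sum_(i | u.2 i == x) row i (set_val u.1) =
    \sum_(i | v.2 i == x) row i (set_val v.1).

Definition sim : rel dom := fun u v => `[< sim_prop u v >].

Lemma sim_refl : reflexive sim.
Proof. by move=> u; apply/asboolP; split. Qed.

Lemma sim_sym : symmetric sim.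
Proof.
suff h u v : sim u v -> sim v u by move=> u v; apply/idP/idP; exact: h.
by move=> /asboolP[e h]; apply/asboolP; split=> // x; rewrite h.
Qed.

Lemma sim_trans : transitive sim.
Proof.
move=> v u w /asboolP[e h] /asboolP[e' h']; apply/asboolP.
by split=> [|x]; [rewrite e | rewrite h].
Qed.

Canonical sim_equiv := EquivRel sim sim_refl sim_sym sim_trans.

(* {eq_quot sim} alone carries no topology; quotient_topology adds the quotient
   topology. *)
Definition wconf : Type := quotient_topology {eq_quot sim}.
HB.instance Definition _ := Quotient.copy wconf (quotient_topology {eq_quot sim}).
HB.instance Definition _ := Topological.copy wconf (quotient_topology {eq_quot sim}).
End Dom.

Section SymmetricPowers.
Context (R : realType) (d : nat).

(* Sym^n (C^d) is the space of forms of degree n in d variables, topologized by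
   its coordinates in the basis of monomials. *)
Definition sym_coord (n : nat) (p : dhomog d (C R) n) :
  {ptws multinom d -> C R} := fun a => mcoeff a (mpoly_of_dhomog p).

Definition Sym (n : nat) : Type := initial_topology (@sym_coord n).
HB.instance Definition _ n := Topological.on (Sym n).

(* The inclusion of C^d = Sym^1 (C^d) in the symmetric algebra. *)
Definition linform (v : 'rV[C R]_d) : mpoly d (C R) :=
  \sum_(j < d) v 0 j *: mpolyX (C R) (mnm1 j).

Lemma linform_homog v : linform v \is ishomog1 1 mdeg.
Proof.
rewrite /linform; apply: rpred_sum => j _; apply: rpredZ.
by rewrite dhomogX /= mdeg1.
Qed.

End SymmetricPowers.

Definition gbinom (F : fieldType) (y : F) (i : nat) : F :=
  (\prod_(l < i) (y - l%:R)) / i`!%:R.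

(* In a sum of exponents equal to n each exponent is at most n, so exponents in
   'I_n.+1 suffice. *)
Definition e_pol (F : fieldType) (A : comAlgType F) (k n : nat)
    (y : 'I_k -> F) (x : 'I_k -> A) : A :=
  \sum_(a : {ffun 'I_k -> 'I_n.+1} | (\sum_i a i == n)%N)
    (\prod_i gbinom (y i) (a i)) *: \prod_i x i ^+ a i.

Lemma e_pol_homog (R : realType) (d k n : nat) (y : 'I_k -> C R)
    (v : 'I_k -> 'rV[C R]_d) :
  e_pol n y (fun i => linform (v i)) \is ishomog1 n mdeg.
Proof.
rewrite /e_pol; apply: rpred_sum => a /eqP an; apply: rpredZ.
suff: \prod_i linform (v i) ^+ a i \is ishomog1 (\sum_i a i)%N mdeg by rewrite an.
apply: (big_ind2 (fun (p : mpoly d (C R)) (m : nat) => p \is ishomog1 m mdeg)).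
- exact: dhomog1.
- by move=> p m q m' hp hq; exact: dhomogM.
- by move=> i _; rewrite -[X in ishomog1 X]mul1n; apply/dhomogMn/linform_homog.
Qed.

Definition e_sym (R : realType) (d k n : nat) (y : 'I_k -> C R)
    (v : 'I_k -> 'rV[C R]_d) : Sym R d n :=
  DHomog (e_pol_homog n y v).

Section Delta.
Context (R : realType) (d k r N : nat) (X : set 'rV[C R]_d).

(* The index i : 'I_N stands for the degree i + 1, so degrees run from 1 to N. *)
Definition sym_prod : Type :=
  {ptws 'I_r -> prod_topology (fun i : 'I_N => Sym R d i.+1)}.
HB.instance Definition _ := Topological.on sym_prod.

Definition e_map (u : dom k r X) : weights R k r * sym_prod :=
  (u.1, fun (j : 'I_r) (i : 'I_N) =>
          e_sym i.+1 (fun l => set_val u.1 l j) (fun l => set_val (u.2 l))).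

(* The image for a given N. As a type it has the subspace topology. *)
Definition Delta : set (weights R k r * sym_prod) := range e_map.

Lemma e_map_range (u : dom k r X) : e_map u \in Delta.
Proof. by rewrite inE; exists u. Qed.

Definition to_Delta (u : dom k r X) : Delta := SigSub (e_map_range u).
End Delta.
Arguments Delta {R d} k r N X.

Definition homeomorphism (S T : topologicalType) (f : S -> T) :=
  continuous f /\ exists g : T -> S, [/\ continuous g, cancel f g & cancel g f].

(* Main.v *)
(* Let p_n = sum_i m_i x_i^n. Newton's identities express e_1, ..., e_n
   polynomially in p_1, ..., p_n and conversely, and p_n depends only on the
   total weight at each point, so the map factors through the quotient by ~.
   Conversely, a linear form phi separating the points turns the data into
   weighted scalars phi(x_i); pairing p_0, ..., p_2k with a polynomial of degree
   at most 2k vanishing at all points but one recovers the weight there, whence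
   injectivity as soon as N >= 2k.
   The inverse is continuous because the map is proper: along an ultrafilter on
   which the weights and the e_n converge, the points stay bounded. Otherwise,
   dividing by the largest coordinate and passing to the limit yields w_i, not
   all zero, with sum_i m_i w_i^n = 0 for 0 < n <= 2k, so that the weights at
   some nonzero point add up to 0, which is excluded. Hence the points converge
   along the ultrafilter, and by injectivity the limit lies in the right class. *)

Require Import Defs.
From mathcomp Require mpoly.
Import -(notations) mpoly.
From mathcomp Require Import all_boot all_order all_algebra generic_quotient.
From mathcomp Require Import complex.
From mathcomp Require Import all_classical all_reals all_analysis.
Set Implicit Arguments.
Unset Strict Implicit.
Unset Printing Implicit Defensive.
Import Order.TTheory GRing.Theory Num.Theory.
Import numFieldNormedType.Exports.
Local Open Scope classical_set_scope.
Local Open Scope ring_scope.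
Local Open Scope quotient_scope.

(** * Newton's identities *)

Definition psum (F : fieldType) (A : comAlgType F) (k n : nat)
    (y : 'I_k -> F) (x : 'I_k -> A) : A := \sum_i y i *: x i ^+ n.

Section Newton.
Context (F : fieldType) (A : comAlgType F).
Hypothesis F0 : [pchar F] =i pred0.

Lemma gbinom0 (y : F) : gbinom y 0 = 1.
Proof. by rewrite /gbinom big_ord0 fact0 divr1. Qed.

Lemma gbinomS (y : F) n : n.+1%:R * gbinom y n.+1 = (y - n%:R) * gbinom y n.
Proof.
rewrite /gbinom big_ord_recr /= factS natrM invfM mulrCA mulVKf.
  by rewrite mulrAC mulrC.
by move/pcharf0P: F0 => ->.
Qed.

Definition eqmodX N (p q : {poly A}) := forall n, (n < N)%N -> p`_n = q`_n.

Lemma eqmodX_mul N p p' q q' :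
  eqmodX N p p' -> eqmodX N q q' -> eqmodX N (p * q) (p' * q').
Proof.
move=> pp' qq' n nN; rewrite !coefM; apply: eq_bigr => i _.
rewrite pp' ?qq' //; first by apply: leq_ltn_trans nN; exact: leq_subr.
by apply: leq_ltn_trans nN; rewrite -ltnS.
Qed.

(** The expansion of (1 + x t)^y, cut after degree N so that its derivative is still exact modulo
    t^N. The product of these over i is the generating function of the e_n, as [e_pol_coef]
    records. *)
Definition binomial_series N (y : F) (x : A) : {poly A} :=
  \poly_(i < N.+1) (gbinom y i *: x ^+ i).

Lemma coef_prod_sum k n (p : 'I_k -> {poly A}) :
  (\prod_i p i)`_n =
  \sum_(a : {ffun 'I_k -> 'I_n.+1} | (\sum_i a i == n)%N) \prod_i (p i)`_(a i).
Proof.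
(* Cutting every factor after degree n does not affect the n-th coefficient, and makes each factor a
   sum over 'I_n.+1, so that the product can be distributed. *)
have h : eqmodX n.+1 (\prod_i p i)
    (\prod_i \sum_(j < n.+1) (p i)`_j *: 'X^j).
  apply: (@big_ind2 _ _ (eqmodX n.+1)) => // [p1 p2 q1 q2|i _ j jn].
    exact: eqmodX_mul.
  by rewrite -poly_def coef_poly jn.
rewrite h // bigA_distr_bigA /= coef_sum [RHS]big_mkcond /=.
apply: eq_bigr => a _; rewrite scaler_prod prodrXr coefZ coefXn eq_sym.
by case: eqP; rewrite ?mulr1 ?mulr0.
Qed.

Lemma e_pol_coef k n N (y : 'I_k -> F) (x : 'I_k -> A) : (n <= N)%N ->
  e_pol n y x = (\prod_i binomial_series N (y i) (x i))`_n.
Proof.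
move=> nN; rewrite coef_prod_sum; apply: eq_bigr => a _.
rewrite -scaler_prod; apply: eq_bigr => i _.
by rewrite coef_poly ltnS (leq_trans _ nN) // -ltnS.
Qed.

Lemma e_pol0 k (y : 'I_k -> F) (x : 'I_k -> A) : e_pol 0 y x = 1.
Proof.
rewrite (@e_pol_coef k 0 0) // coef0_prod big1 // => i _.
by rewrite coef_poly /= gbinom0 scale1r.
Qed.

(* Modulo t^N, the logarithmic derivative y x / (1 + x t) of (1 + x t)^y. *)
Definition dlog N (y : F) (x : A) : {poly A} :=
  (y *: x) *: \sum_(i < N) (- x *: 'X) ^+ i.

Lemma coef_dlog N y x n : (n < N)%N ->
  (dlog N y x)`_n = (-1) ^+ n *: (y *: x ^+ n.+1).
Proof.
move=> nN; rewrite coefZ coef_sum (bigD1 (Ordinal nN)) //= big1 => [|i ni].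
  rewrite addr0 exprZn coefZ coefXn eqxx mulr1 -scaleN1r exprZn.
  by rewrite -scalerAl -scalerAr -exprS scalerA mulrC -scalerA.
rewrite exprZn coefZ coefXn; case: eqP => [e|]; last by rewrite mulr0.
by case/eqP: ni; apply: val_inj.
Qed.

(** The recurrence [gbinomS] amounts to (1 + x t) G' = y x G modulo t^N for the truncated series G.
    Multiplying by the truncated geometric series [U], an inverse of 1 + x t modulo t^N, isolates
    G'. *)
Lemma binomial_series_deriv N y x :
  eqmodX N (binomial_series N y x)^`() (dlog N y x * binomial_series N y x).
Proof.
pose U : {poly A} := \sum_(i < N) (- x *: 'X) ^+ i.
have hU : eqmodX N (U * (1 + x *: 'X)) 1.
  have -> : U * (1 + x *: 'X) = 1 - (- x *: 'X) ^+ N.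
    rewrite -[1 - _]opprB subrX1 -/U mulrC -mulNr; congr (_ * _).
    by rewrite scaleNr opprB opprK.
  move=> n nN; rewrite coefB exprZn coefZ coefXn.
  by rewrite ltn_eqF // mulr0 subr0.
have h : eqmodX N ((1 + x *: 'X) * (binomial_series N y x)^`())
    ((y *: x) *: binomial_series N y x).
  move=> n nN; rewrite mulrDl mul1r coefD -scalerAl [RHS]coefZ coefZ coefXM.
  rewrite !coef_deriv !coef_poly ltnS nN (ltnW nN : (n < N.+1)%N).
  case: n nN => [|n] nN /=.
    have y1 : gbinom y 1 = y.
      by have := gbinomS y 0; rewrite mul1r subr0 gbinom0 mulr1.
    by rewrite mulr0 addr0 mulr1n expr0 gbinom0 scale1r mulr1 y1.
  rewrite ltnS (ltnW nN) -!scaler_nat -!scalerAr -!scalerAl -!exprS !scalerA.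
  by rewrite -scalerDl gbinomS mulrBl subrK mulrC.
move=> n nN; rewrite -[_^`()]mul1r.
have <- : (U * (1 + x *: 'X) * (binomial_series N y x)^`())`_n =
    (1 * (binomial_series N y x)^`())`_n.
  exact: (eqmodX_mul hU).
by rewrite -mulrA (eqmodX_mul (fun n _ => erefl) h) // -scalerAr scalerAl.
Qed.

Lemma prod_deriv N k (G P : 'I_k -> {poly A}) :
  (forall i, eqmodX N (G i)^`() (P i * G i)) ->
  eqmodX N (\prod_i G i)^`() ((\sum_i P i) * \prod_i G i).
Proof.
move=> h; apply: (big_rec2 (fun p q => eqmodX N q^`() (p * q))).
  by rewrite mul0r derivC.
move=> i p q _ hpq n nN; rewrite derivM mulrDl coefD.
rewrite (eqmodX_mul (h i) (fun n _ => erefl)) //.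
rewrite (eqmodX_mul (fun n _ => erefl) hpq) //.
by rewrite -!coefD mulrCA -mulrA -mulrDl.
Qed.

(** Logarithmic derivatives add up, so G' = (sum of the [dlog]) G for the product G of the binomial
    series. The coefficients of t^n on both sides are compared: that of t^j in the sum of the [dlog]
    is (-1)^j p_(j+1). *)
Lemma newton k n (y : 'I_k -> F) (x : 'I_k -> A) :
  n.+1%:R *: e_pol n.+1 y x =
  \sum_(j < n.+1) (-1) ^+ j *: (psum j.+1 y x * e_pol (n - j) y x).
Proof.
rewrite (@e_pol_coef k n.+1 n.+1) // scaler_nat -coef_deriv.
rewrite (prod_deriv (fun i => @binomial_series_deriv n.+1 (y i) (x i))) //
  coefM.
apply: eq_bigr => j _; rewrite -e_pol_coef; last first.
  by apply: leq_trans (leq_subr _ _) _.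
rewrite coef_sum scalerAl; congr (_ * _); rewrite scaler_sumr.
by apply: eq_bigr => i _; exact: coef_dlog.
Qed.

Lemma eq_e_pol k l n (y : 'I_k -> F) (x : 'I_k -> A)
    (y' : 'I_l -> F) (x' : 'I_l -> A) :
  (forall j, (0 < j <= n)%N -> psum j y x = psum j y' x') ->
  e_pol n y x = e_pol n y' x'.
Proof.
elim/ltn_ind: n => -[|n] IH h; first by rewrite !e_pol0.
(* Characteristic zero allows the factor n + 1 of Newton's identity to be cancelled. *)
have n0 : n.+1%:R != 0 :> F by move/pcharf0P: F0 => ->.
apply: (scalerI n0); rewrite !newton; apply: eq_bigr => j _.
rewrite h ?ltn_ord //; congr (_ *: (_ * _)); apply: IH => [|i /andP[i0 ij]].
  by rewrite ltnS leq_subr.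
by apply: h; rewrite i0 (leq_trans ij) // (leq_trans (leq_subr _ _)).
Qed.

(** Newton's identity is solved for its last term, j = n, where e_0 = 1. No division occurs in this
    direction. *)
Lemma psumS k n (y : 'I_k -> F) (x : 'I_k -> A) :
  psum n.+1 y x = (-1) ^+ n *: (n.+1%:R *: e_pol n.+1 y x -
    \sum_(j < n) (-1) ^+ j *: (psum j.+1 y x * e_pol (n - j) y x)).
Proof.
rewrite newton big_ord_recr /= addrAC subrr add0r subnn e_pol0 mulr1 scalerA.
by rewrite -expr2 sqrr_sign scale1r.
Qed.

Lemma eq_psum k l n (y : 'I_k -> F) (x : 'I_k -> A)
    (y' : 'I_l -> F) (x' : 'I_l -> A) :
  (forall j, (0 < j <= n)%N -> e_pol j y x = e_pol j y' x') ->
  forall j, (0 < j <= n)%N -> psum j y x = psum j y' x'.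
Proof.
move=> h; elim/ltn_ind => -[//|j] IH jn.
rewrite !psumS h //; congr (_ *: (_ - _)); apply: eq_bigr => i _.
have ij := ltn_ord i.
rewrite h ?subn_gt0 ?ij ?(leq_trans (leq_subr _ _) (ltnW jn)) //.
by rewrite IH // (leq_trans ij (ltnW jn)).
Qed.

End Newton.

(** * Weights recovered from moments *)

Lemma sum_horner (F : fieldType) k (y x : 'I_k -> F) (q : {poly F}) :
  \sum_i y i * q.[x i] = \sum_(n < size q) q`_n * \sum_i y i * x i ^+ n.
Proof.
under eq_bigr do rewrite horner_coef mulr_sumr.
rewrite exchange_big; apply: eq_bigr => n _; rewrite mulr_sumr.
by apply: eq_bigr => i _; rewrite mulrCA.
Qed.

Lemma eq_weight_of_moments (F : fieldType) k l (y x : 'I_k -> F)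
    (y' x' : 'I_l -> F) (z : F) :
  (forall n, (n <= k + l)%N ->
     \sum_i y i * x i ^+ n = \sum_i y' i * x' i ^+ n) ->
  \sum_(i | x i == z) y i = \sum_(i | x' i == z) y' i.
Proof.
move=> h.
(* The roots of [q] are all the points of both families other than z. Its degree is at most k + l,
   so pairing with it involves only the moments assumed equal, and leaves the weight at z times
   q(z). *)
pose q := \prod_(i | x i != z) ('X - (x i)%:P) *
          \prod_(i | x' i != z) ('X - (x' i)%:P).
have qx i : x i != z -> q.[x i] = 0.
  move=> xz; rewrite hornerM horner_prod (bigD1 i) //=.
  by rewrite hornerXsubC subrr !mul0r.
have qx' i : x' i != z -> q.[x' i] = 0.
  move=> xz; rewrite hornerM mulrC horner_prod (bigD1 i) //=.
  by rewrite hornerXsubC subrr !mul0r.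
have qz : q.[z] != 0.
  rewrite hornerM !horner_prod mulf_neq0 //; apply/prodf_neq0 => i ?;
    by rewrite hornerXsubC subr_eq0 eq_sym.
have sz m (P : pred 'I_m) (u : 'I_m -> F) :
    (size (\prod_(i | P i) ('X - (u i)%:P))%R <= m.+1)%N.
  rewrite -big_filter size_prod_XsubC ltnS size_filter.
  by rewrite (leq_trans (count_size _ _)) //
    /index_enum unlock -enumT -cardE card_ord.
have sq : (size q <= (k + l).+1)%N.
  apply: leq_trans (size_polyMleq _ _) _.
  rewrite -subn1 leq_subLR add1n -addnS -addSn.
  exact: leq_add.
have e : \sum_i y i * q.[x i] = \sum_i y' i * q.[x' i].
  rewrite !sum_horner; apply: eq_bigr => n _; congr (_ * _); apply: h.
  by rewrite -ltnS (leq_trans _ sq).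
have r m (u v : 'I_m -> F) : (forall i, v i != z -> q.[v i] = 0) ->
    \sum_i u i * q.[v i] = (\sum_(i | v i == z) u i) * q.[z].
  move=> q0; rewrite mulr_suml [RHS]big_mkcond; apply: eq_bigr => i _.
  by case: eqP => [->//|/eqP/q0 ->]; rewrite mulr0.
by move: e; rewrite !r // => /(mulIf qz).
Qed.

(** * Invariance and injectivity *)

Definition dot (F : fieldType) (d : nat) (phi : 'I_d -> F) (v : 'rV[F]_d) : F :=
  \sum_(j < d) v 0 j * phi j.

Lemma exists_nonroot (F : numFieldType) (p : {poly F}) :
  p != 0 -> exists c, p.[c] != 0.
Proof.
(* These are [size p] distinct elements, one more than the degree, so they cannot all be roots. *)
move=> p0; pose s := [seq (n%:R : F) | n <- iota 0 (size p)].
have us : uniq s.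
  by rewrite map_inj_uniq ?iota_uniq // => m n /eqP; rewrite eqr_nat => /eqP.
have [/allP h|/allPn[c _ rc]] := boolP (all (root p) s); last by exists c.
have := max_poly_roots p0 (introT allP h) us.
by rewrite size_map size_iota ltnn.
Qed.

(** The form is sought on the moment curve (1, c, c^2, ...). For v different from w, its value at v
    - w is a nonzero polynomial in c; any c that is not a root of the product over all such pairs
    will do. *)
Lemma exists_separating (F : numFieldType) d (s : seq 'rV[F]_d) :
  exists phi, {in s &, injective (dot phi)}.
Proof.
pose P (v : 'rV[F]_d) : {poly F} := \sum_j v 0 j *: 'X^j.
have P0 v : v != 0 -> P v != 0.
  apply: contra => /eqP h; apply/eqP/rowP => j; rewrite mxE.
  have := congr1 (fun p : {poly F} => p`_j) h.
  rewrite coef0 coef_sum (bigD1 j) //= coefZ coefXn eqxx mulr1 big1 ?addr0 //.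
  by move=> i ij; rewrite coefZ coefXn eq_sym (inj_eq val_inj) (negPf ij) mulr0.
pose Q := \prod_(v <- s) \prod_(w <- s | v - w != 0) P (v - w).
have /exists_nonroot[c Qc] : Q != 0.
  rewrite /Q !prodf_seq_neq0; apply/allP => v _ /=.
  by rewrite prodf_seq_neq0; apply/allP => w _; apply/implyP => /P0.
exists (fun j => c ^+ j) => v w vs ws e.
apply/eqP; rewrite -subr_eq0; apply: contraNT Qc => vw.
rewrite /Q (big_rem v) //= hornerM (big_rem w) //= vw hornerM.
rewrite [(P _).[c]](_ : _ = 0) ?mul0r //.
rewrite horner_sum; under eq_bigr do rewrite hornerZ hornerXn !mxE mulrBl.
by rewrite sumrB; apply/eqP; rewrite subr_eq0; apply/eqP.
Qed.

Lemma sum_partition_seq (V : nmodType) (I : finType) (T : eqType) (u : I -> T)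
    (s : seq T) (G : I -> V) :
  uniq s -> (forall i, u i \in s) ->
  \sum_i G i = \sum_(x <- s) \sum_(i | u i == x) G i.
Proof.
move=> us su; rewrite (exchange_big_dep predT) //=; apply: eq_bigr => i _.
rewrite -big_filter (_ : [seq x <- s | u i == x] = [:: u i]) ?big_seq1 //.
rewrite -(filter_pred1_uniq us (su i)).
by apply: eq_filter => x; rewrite /= eq_sym.
Qed.

Lemma psum_fiber (F : fieldType) (A : comAlgType F) k n (T : eqType)
    (y : 'I_k -> F) (u : 'I_k -> T) (g : T -> A) (s : seq T) :
  uniq s -> (forall i, u i \in s) ->
  psum n y (fun i => g (u i)) =
  \sum_(x <- s) (\sum_(i | u i == x) y i) *: g x ^+ n.
Proof.
move=> us su; rewrite /psum (sum_partition_seq _ us su); apply: eq_bigr => x _.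
by rewrite scaler_suml; apply: eq_bigr => i /eqP ->.
Qed.

(** By Newton's identities only power sums need comparing, and grouping their terms by fibre leaves
    only the total weight of each fibre. *)
Lemma eq_e_pol_fiber (F : fieldType) (A : comAlgType F) k n (T : eqType)
    (y y' : 'I_k -> F) (u v : 'I_k -> T) (g : T -> A) :
  [pchar F] =i pred0 ->
  (forall x, \sum_(i | u i == x) y i = \sum_(i | v i == x) y' i) ->
  e_pol n y (fun i => g (u i)) = e_pol n y' (fun i => g (v i)).
Proof.
move=> F0 h; apply: (eq_e_pol F0) => j _.
pose s := undup (codom u ++ codom v).
rewrite !(@psum_fiber _ _ _ _ _ _ _ _ s) ?undup_uniq //.
- by apply: eq_bigr => x _; rewrite h.
- by move=> i; rewrite mem_undup mem_cat codom_f orbT.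
- by move=> i; rewrite mem_undup mem_cat codom_f.
Qed.

Section Invariance.
Context (R : realType) (d k r : nat) (X : set 'rV[C R]_d).
Implicit Types u v : dom k r X.

Lemma meval_linform (phi : 'I_d -> C R) (v : 'rV[C R]_d) :
  meval phi (linform v) = dot phi v.
Proof.
rewrite /linform raddf_sum; apply: eq_bigr => j _.
by rewrite /= mevalZ mevalXU.
Qed.

(** Evaluation at [phi] is the algebra morphism from the symmetric algebra to C extending the linear
    form [dot phi], so it commutes with e_n. The type [(C R)^o] is the field as an algebra over
    itself. *)
Lemma meval_e_pol (phi : 'I_d -> C R) l n (y : 'I_l -> C R)
    (x : 'I_l -> 'rV[C R]_d) :
  meval phi (e_pol n y (fun i => linform (x i))) =
  e_pol n y (fun i => dot phi (x i) : (C R)^o).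
Proof.
rewrite /e_pol raddf_sum; apply: eq_bigr => a _; rewrite /= mevalZ; congr (_ * _).
rewrite rmorph_prod; apply: eq_bigr => i _.
by rewrite rmorphXn /= meval_linform.
Qed.

Lemma e_map_sim N u v : sim u v -> e_map N u = e_map N v.
Proof.
move=> /asboolP[e1 e2]; rewrite /e_map -e1; congr pair.
apply: functional_extensionality_dep => j.
apply: functional_extensionality_dep => i; apply: val_inj => /=.
apply: (eq_e_pol_fiber _ (fun x : X => linform (set_val x))).
  exact: pchar_num.
move=> x; have := congr1 (fun w : 'rV_r => w 0 j) (e2 x).
rewrite !summxE e1; under eq_bigr do rewrite mxE.
by under [X in _ = X -> _]eq_bigr do rewrite mxE.
Qed.

(** The hypothesis concerns scalars only, so that it can be met both by an equality of images under
    [e_map] and by a uniqueness of limits. *)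
Lemma sim_e_pol u v : u.1 = v.1 ->
  (forall (j : 'I_r) (phi : 'I_d -> C R) n, (0 < n <= k + k)%N ->
     e_pol n (fun l => set_val u.1 l j)
       (fun l => dot phi (set_val (u.2 l)) : (C R)^o) =
     e_pol n (fun l => set_val v.1 l j)
       (fun l => dot phi (set_val (v.2 l)) : (C R)^o)) ->
  sim u v.
Proof.
move=> e1 e2; apply/asboolP; split=> // x; apply/rowP => j.
(* The form must also tell x apart from the points of [u] and [v], for x need not be among them. *)
pose s := set_val x :: [seq set_val (u.2 l) | l : 'I_k] ++
                       [seq set_val (v.2 l) | l : 'I_k].
have [phi phiP] := exists_separating s.
rewrite !summxE.
under eq_bigr do rewrite mxE; under [RHS]eq_bigr do rewrite mxE.
have hu l : (u.2 l == x) = (dot phi (set_val (u.2 l)) == dot phi (set_val x)).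
  apply/eqP/eqP => [->//|h]; apply: val_inj; apply: phiP h.
    by rewrite inE mem_cat codom_f orbT.
  by rewrite inE eqxx.
have hv l : (v.2 l == x) = (dot phi (set_val (v.2 l)) == dot phi (set_val x)).
  apply/eqP/eqP => [->//|h]; apply: val_inj; apply: phiP h.
    by rewrite inE mem_cat codom_f !orbT.
  by rewrite inE eqxx.
under eq_bigl do rewrite hu; under [RHS]eq_bigl do rewrite hv.
(* The hypothesis starts in degree 1; the zeroth moments agree because the weights do. *)
apply: eq_weight_of_moments => n nk; case: n nk => [|n] nk.
  by rewrite e1; apply: eq_bigr => l _; rewrite !expr0.
exact: (eq_psum (@pchar_num _) (e2 j phi)).
Qed.
End Invariance.

(** * Continuity *)

Section FieldLimits.
Context (K : numFieldType) (Z : Type) (F : set_system Z).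
Context {FF : Filter F}.

Lemma cvg_sumr (I : Type) (s : seq I) (P : pred I) (f : I -> Z -> K)
    (l : I -> K) :
  (forall i, P i -> f i @ F --> l i) ->
  (fun z => \sum_(i <- s | P i) f i z) @ F --> \sum_(i <- s | P i) l i.
Proof.
move=> h; elim: s => [|i s IH].
  by rewrite big_nil; under eq_fun do rewrite big_nil; exact: cvg_cst.
rewrite big_cons; under eq_fun do rewrite big_cons; case Pi : (P i) => //.
by apply: cvgD => //; exact: h.
Qed.

Lemma cvg_prodr (I : Type) (s : seq I) (P : pred I) (f : I -> Z -> K)
    (l : I -> K) :
  (forall i, P i -> f i @ F --> l i) ->
  (fun z => \prod_(i <- s | P i) f i z) @ F --> \prod_(i <- s | P i) l i.
Proof.
move=> h; elim: s => [|i s IH].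
  by rewrite big_nil; under eq_fun do rewrite big_nil; exact: cvg_cst.
rewrite big_cons; under eq_fun do rewrite big_cons; case Pi : (P i) => //.
by apply: cvgM => //; exact: h.
Qed.

Lemma cvg_exprn (f : Z -> K) (l : K) n :
  f @ F --> l -> (fun z => f z ^+ n) @ F --> l ^+ n.
Proof.
move=> fl; elim: n => [|n IH].
  by rewrite expr0; under eq_fun do rewrite expr0; exact: cvg_cst.
by rewrite exprS; under eq_fun do rewrite exprS; exact: cvgM.
Qed.

Lemma cvg_gbinom (f : Z -> K) (l : K) n :
  f @ F --> l -> (fun z => gbinom (f z) n) @ F --> gbinom l n.
Proof.
move=> fl; apply: cvgMr_tmp; apply: cvg_prodr => i _.
by apply: cvgB => //; exact: cvg_cst.
Qed.

End FieldLimits.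

Section InitialLimits.

(** Subspaces and [Sym] carry initial topologies, and products a supremum of such. This lemma and
    those after it reduce convergence to complex coordinates. *)
Lemma cvg_initial (S : choiceType) (T : topologicalType) (f : S -> T)
    (F : set_system S) (s : initial_topology f) :
  Filter F -> f @ F --> f s -> F --> s.
Proof.
move=> FF h A /= [_ [[B Bo <-] Bs BA]]; apply: filterS BA _.
by apply: h; exact: open_nbhs_nbhs.
Qed.

Lemma cvg_prod_topology (I : Type) (T : I -> topologicalType) (Z : Type)
    (F : set_system Z) (h : Z -> prod_topology T) (g : prod_topology T) :
  Filter F -> (forall i, (fun z => h z i) @ F --> g i) -> h @ F --> g.
Proof.
move=> FF hg; apply/cvg_sup => i; apply: cvg_initial; exact: hg.
Qed.

Lemma cvg_set_val (T : topologicalType) (A : set T) (Z : Type)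
    (F : set_system Z) (h : Z -> A) (a : A) :
  Filter F -> (fun z => set_val (h z)) @ F --> set_val a -> h @ F --> a.
Proof. by move=> FF ha; apply: cvg_initial; exact: ha. Qed.

Lemma cvg_mx (T : topologicalType) m n (Z : Type) (F : set_system Z)
    (h : Z -> 'M[T]_(m, n)) (a : 'M[T]_(m, n)) :
  Filter F -> (forall i j, (fun z => h z i j) @ F --> a i j) -> h @ F --> a.
Proof.
move=> FF ha A [P PP PA]; rewrite nbhs_simpl /=.
have h1 : F [set z | forall i j, P i j (h z i j)].
  by apply: filter_forall => i; apply: filter_forall => j; apply: ha; apply: PP.
by apply: filterS h1 => z Pz; exact: PA.
Qed.

Lemma coord_mx_continuous (T : topologicalType) m n i j :
  continuous (fun M : 'M[T]_(m, n) => M i j).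
Proof.
move=> M A MA; exists (fun i' j' => [set x | (i', j') = (i, j) -> A x]).
  move=> i' j'; have [[-> ->]|ne] := pselect ((i', j') = (i, j)).
    by apply: filterS MA => x Ax _.
  by apply: filterS filterT => x _ /= /ne.
by move=> M' /(_ i j); apply.
Qed.

End InitialLimits.

Section PolynomialLimits.
Context (R : realType) (d : nat) (Z : Type) (F : set_system Z).
Context {FF : Filter F}.
Local Notation mp := (mpoly d (C R)).

(** This is convergence in [Sym], coefficient by coefficient, but free of the degree, so that it
    passes through the products and powers inside [e_pol]. *)
Definition mcvg (h : Z -> mp) (p : mp) :=
  forall a, (fun z => mcoeff a (h z)) @ F --> mcoeff a p.

Lemma mcvg_cst p : mcvg (fun=> p) p.
Proof. by move=> a; exact: cvg_cst. Qed.

Lemma mcvg_mul h p h' p' : mcvg h p -> mcvg h' p' ->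
  mcvg (fun z => h z * h' z) (p * p').
Proof.
move=> hp hp' a; rewrite mcoeffM; under eq_fun do rewrite mcoeffM.
by apply: cvg_sumr => m _; apply: cvgM.
Qed.

Lemma mcvg_scale (c : Z -> C R) (l : C R) h p : c @ F --> l -> mcvg h p ->
  mcvg (fun z => c z *: h z) (l *: p).
Proof.
move=> cl hp a; rewrite mcoeffZ; under eq_fun do rewrite mcoeffZ.
exact: (cvgM cl (hp a)).
Qed.

Lemma mcvg_sum (I : Type) (s : seq I) (P : pred I) h p :
  (forall i, P i -> mcvg (h i) (p i)) ->
  mcvg (fun z => \sum_(i <- s | P i) h i z) (\sum_(i <- s | P i) p i).
Proof.
move=> hp a; rewrite raddf_sum; under eq_fun do rewrite raddf_sum.
by apply: cvg_sumr => i Pi; exact: hp.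
Qed.

Lemma mcvg_prod (I : Type) (s : seq I) h p :
  (forall i, mcvg (h i) (p i)) ->
  mcvg (fun z => \prod_(i <- s) h i z) (\prod_(i <- s) p i).
Proof.
move=> hp; elim: s => [|i s IH].
  by rewrite big_nil; under eq_fun do rewrite big_nil; exact: mcvg_cst.
rewrite big_cons; under eq_fun do rewrite big_cons.
exact: (mcvg_mul (hp i) IH).
Qed.

Lemma mcvg_exp h p n : mcvg h p -> mcvg (fun z => h z ^+ n) (p ^+ n).
Proof.
move=> hp; elim: n => [|n IH].
  by rewrite expr0; under eq_fun do rewrite expr0; exact: mcvg_cst.
rewrite exprS; under eq_fun do rewrite exprS.
exact: (mcvg_mul hp IH).
Qed.

Lemma mcvg_e_pol k n (y : Z -> 'I_k -> C R) (y0 : 'I_k -> C R)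
    (v : Z -> 'I_k -> 'rV[C R]_d) (v0 : 'I_k -> 'rV[C R]_d) :
  (forall i, (fun z => y z i) @ F --> y0 i) ->
  (forall i j, (fun z => v z i 0 j) @ F --> v0 i 0 j) ->
  mcvg (fun z => e_pol n (y z) (fun i => linform (v z i)))
       (e_pol n y0 (fun i => linform (v0 i))).
Proof.
move=> yy0 vv0; apply: mcvg_sum => a _; apply: mcvg_scale.
  by apply: cvg_prodr => i _; exact: cvg_gbinom.
apply: mcvg_prod => i; apply: mcvg_exp; apply: mcvg_sum => j _.
by apply: mcvg_scale => //; exact: mcvg_cst.
Qed.

Lemma cvg_meval_coord (phi : Z -> 'I_d -> C R) (phi0 : 'I_d -> C R) (p : mp) :
  (forall j, (fun z => phi z j) @ F --> phi0 j) ->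
  (fun z => meval (phi z) p) @ F --> meval phi0 p.
Proof.
move=> h; rewrite mevalE; under eq_fun do rewrite mevalE.
apply: cvg_sumr => m _; apply: cvgMl_tmp; apply: cvg_prodr => j _.
exact: cvg_exprn.
Qed.

(** The sum runs over a finite set of monomials that depends on n alone and not on the support of p,
    so that a limit in p can be taken term by term. *)
Lemma mevalE_homog n (p : mp) (phi : 'I_d -> C R) : p \is ishomog1 n mdeg ->
  meval phi p = \sum_(m : bmultinom d n.+1)
    mcoeff m p * \prod_j phi j ^+ fun_of_multinom m j.
Proof.
move=> /dhomogP hp.
have h : (mmeasure mdeg p <= n.+1)%N.
  rewrite msizeE big_seq; apply: (big_ind (fun m => (m <= n.+1)%N)) => //.
    by move=> a b; rewrite geq_max => -> ->.
  by move=> m /hp /= ->.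
rewrite {1}(mpolywE h) raddf_sum; apply: eq_bigr => m _.
by rewrite /= mevalZ mevalX.
Qed.

Lemma cvg_meval_homog n (h : Z -> Sym R d n) (p : Sym R d n) phi :
  h @ F --> p ->
  (fun z => meval phi (mpoly_of_dhomog (h z))) @ F -->
  meval phi (mpoly_of_dhomog p).
Proof.
move=> hp; rewrite (mevalE_homog _ (dhomog_is_dhomog p)).
under eq_fun do rewrite (mevalE_homog _ (dhomog_is_dhomog _)).
apply: cvg_sumr => m _; apply: cvgMr_tmp.
have c : continuous (fun q : Sym R d n => mcoeff m (mpoly_of_dhomog q)).
  move=> q; exact: (cvg_comp _ _ (@initial_continuous _ _ (@sym_coord R d n) q)
    (@proj_continuous _ (fun=> C R) (bmnm m) (sym_coord q))).
exact: (cvg_comp _ _ hp (c p)).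
Qed.

End PolynomialLimits.

Section EMap.
Context (R : realType) (d k r N : nat) (X : set 'rV[C R]_d).

Lemma cvg_dom (Z : Type) (F : set_system Z) (h : Z -> dom k r X)
    (u : dom k r X) :
  Filter F ->
  (forall i j, (fun z => set_val (h z).1 i j) @ F --> set_val u.1 i j) ->
  (forall i j, (fun z => set_val ((h z).2 i) 0 j) @ F --> set_val (u.2 i) 0 j) ->
  h @ F --> u.
Proof.
move=> FF h1 h2.
have g1 : (fun z => (h z).1) @ F --> u.1 by apply: cvg_set_val; apply: cvg_mx.
have g2 : (fun z => (h z).2) @ F --> u.2.
  apply: cvg_prod_topology => i; apply: cvg_set_val; apply: cvg_mx => i' j.
  by rewrite ord1.
move=> A [[P Q] /= [hP hQ] PQ]; rewrite nbhs_simpl /=.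
have FPQ : F [set z | P (h z).1 /\ Q (h z).2].
  by apply: filterI; [exact: g1 hP | exact: g2 hQ].
by apply: filterS FPQ => z [Pz Qz]; exact: PQ.
Qed.

Lemma weight_continuous i j :
  continuous (fun u : dom k r X => set_val u.1 i j).
Proof.
move=> u; have h1 : (fun u : dom k r X => set_val u.1) @ u --> set_val u.1.
  by apply: (cvg_comp _ _ cvg_fst); exact: initial_continuous.
exact: (cvg_comp _ _ h1 (@coord_mx_continuous _ _ _ i j (set_val u.1))).
Qed.

Lemma point_continuous i j :
  continuous (fun u : dom k r X => set_val (u.2 i) 0 j).
Proof.
move=> u; have h1 : (fun u : dom k r X => u.2 i) @ u --> u.2 i.
  have h0 : (fun u : dom k r X => u.2) @ u --> u.2 by exact: cvg_snd.
  pose h2 := @proj_continuous _ (fun=> X : topologicalType) i u.2.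
  have {}h2 : (fun f : {ptws 'I_k -> X} => f i) @ u.2 --> u.2 i by exact: h2.
  exact: (cvg_comp _ _ h0 h2).
have h2 := cvg_comp _ _ h1 (@initial_continuous _ _ (@set_val _ X) (u.2 i)).
exact: (cvg_comp _ _ h2 (@coord_mx_continuous _ _ _ 0 j (set_val (u.2 i)))).
Qed.

Lemma e_map_continuous : continuous (@e_map R d k r N X).
Proof.
move=> u.
have h1 : (fun v => (e_map N v).1) @ u --> (e_map N u).1 by exact: cvg_fst.
have h2 : (fun v => (e_map N v).2) @ u --> (e_map N u).2.
  apply: cvg_prod_topology => j; apply: cvg_prod_topology => i.
  apply: cvg_initial; apply: cvg_prod_topology => a.
  apply: mcvg_e_pol => l; first exact: weight_continuous.
  by move=> c; exact: point_continuous.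
exact: (cvg_pair h1 h2).
Qed.
End EMap.

(** * Properness *)

Lemma cvg_field_unique (K : numFieldType) (Z : Type) (F : set_system Z)
    (f : Z -> K) (a b : K) : ProperFilter F -> f @ F --> a -> f @ F --> b -> a = b.
Proof. by move=> FF; apply: cvg_unique; exact: norm_hausdorff. Qed.

Lemma cvg_mul_expn0 (K : numFieldType) (Z : Type) (F : set_system Z)
    (f g : Z -> K) (a : K) n {FF : Filter F} : n != 0%N ->
  f @ F --> a -> g @ F --> (0 : K) -> (fun z => f z * g z ^+ n) @ F --> (0 : K).
Proof.
move=> n0 fa g0; have p0 : a * 0 ^+ n = 0 by rewrite expr0n (negPf n0) mulr0.
by rewrite -p0; exact: (cvgM fa (@cvg_exprn _ _ _ _ _ _ n g0)).
Qed.

(** * Limits along ultrafilters *)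

Section UltraLimits.
Context (R : realType) (Z : Type) (G : set_system Z).
Context {GU : UltraFilter G}.

Lemma ultra_fmap (T : Type) (f : Z -> T) : UltraFilter (f @ G).
Proof.
split=> [|H HP sub]; first exact: fmap_proper_filter.
apply/seteqP; split=> A; last exact: sub.
move=> HA; have [//|nA] := in_ultra_setVsetC (f @^-1` A) GU.
have /sub/(filterI HA) : (f @ G) (~` A) by [].
by rewrite setICr => /filter_not_empty.
Qed.

(** If no [A i] were in G, all their complements would be, and so would the finite intersection of
    these, which is empty. *)
Lemma ultra_finite_cover (I : finType) (A : I -> set Z) :
  (forall z, exists i, A i z) -> exists i, G (A i).
Proof.
move=> cover; apply: contrapT => /forallNP no.
have : G [set z | forall i, (~` A i) z].
  apply: filter_forall => i.
  by have [/no|] := in_ultra_setVsetC (A i) GU.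
by move=> /filter_ex[z nA]; have [i /nA] := cover z.
Qed.

Lemma ultra_cvg_bounded_real (h : Z -> R) (B : R) :
  G [set z | `|h z| <= B] -> exists l : R, h @ G --> l.
Proof.
move=> hB; have := @segment_compact R (- B) B; rewrite compact_ultra => co.
have hI : G (h @^-1` `[- B, B]).
  by apply: filterS hB => z /=; rewrite in_itv /= -ler_norml.
by have [l [_ hl]] := co (h @ G) (ultra_fmap h) hI; exists l.
Qed.

Lemma cvg_real_complex (h : Z -> R) (l : R) :
  h @ G --> l -> (fun z => (h z)%:C%C : C R) @ G --> (l%:C%C : C R).
Proof.
move=> hl; apply/cvgrPdist_lt => e e0.
(* Complex numbers are comparable only if their imaginary parts agree, so a positive [e] is real. *)
have [eim ere] : complex.Im e = 0 /\ 0 < complex.Re e.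
  by move: (e0 : (0 : R[i]) < e); rewrite ltcE => /andP[/eqP ? ?].
move/cvgrPdist_lt: hl => /(_ _ ere); apply: filterS => z hz.
rewrite -rmorphB.
rewrite (_ : `|_| = (`|l - h z|)%:C%C); first by rewrite ltcE /= eim eqxx.
by rewrite normc_def /= expr0n addr0 sqrtr_sqr.
Qed.

Lemma ultra_cvg_bounded (h : Z -> C R) (B : C R) :
  G [set z | `|h z| <= B] -> exists l : C R, h @ G --> l.
Proof.
move=> hB.
have reB (f : Z -> C R) : G [set z | `|f z| <= B] ->
    exists l : R, (fun z => complex.Re (f z)) @ G --> l.
  move=> fB; apply: (@ultra_cvg_bounded_real _ (complex.Re B)).
  apply: filterS fB => z /= fz.
  have := le_trans (normc_ge_Re (f z)) fz.
  by rewrite lecE => /andP[].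
have [a ha] := reB h hB.
(* The imaginary part of h is the real part of -(i h), which has the same modulus as h. *)
have [|b hb] := reB (fun z => - (h z * 'i%C)).
  apply: filterS hB => z /=; rewrite normrN normrM.
  rewrite [X in _ * X](_ : _ = 1) ?mulr1 //.
  by rewrite normc_def /= expr0n expr1n add0r sqrtr1.
exists (a%:C%C + 'i%C * b%:C%C).
rewrite (_ : h = fun z => (complex.Re (h z))%:C%C +
    'i%C * (complex.Re (- (h z * 'i%C)))%:C%C); last first.
  by apply/funext => z; rewrite raddfN /= ReiNIm opprK -complexE.
apply: cvgD; first exact: cvg_real_complex.
by apply: cvgMl_tmp; exact: cvg_real_complex.
Qed.

(* If some x_i escaped to infinity, rescaling by the largest one would give
   limits w_i, one of them 1, with sum_i m_i w_i^n = 0 for all n > 0: the total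
   weight at the point 1 would vanish. *)
Lemma ultra_cvg_of_moments k r (m : Z -> 'M[C R]_(k, r)) (m0 : 'M[C R]_(k, r))
    (x : Z -> 'I_k -> C R) (p : nat -> 'I_r -> C R) :
  weights R k r m0 ->
  (forall i j, (fun z => m z i j) @ G --> m0 i j) ->
  (forall n j, (0 < n <= k + k)%N ->
     (fun z => \sum_i m z i j * x z i ^+ n) @ G --> p n j) ->
  forall i, exists l : C R, (fun z => x z i) @ G --> l.
Proof.
move=> wm0 mm0 xp i.
(* The index of the largest coordinate varies with z, but takes finitely many values, so one of them
   is valid along G. *)
have [i0 xmax] : exists i0, G [set z | forall i, `|x z i| <= `|x z i0|].
  apply: ultra_finite_cover => z.
  have [i0 _ hi0] := arg_maxP (fun i => complex.Re `|x z i|) (erefl (xpredT i)).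
  exists i0 => i1; have := hi0 i1 erefl; rewrite /= lecE => ->.
  by rewrite !normc_def /= eqxx.
have [[B xB]|] := pselect (exists B, G [set z | `|x z i0| <= B]).
  apply: (@ultra_cvg_bounded _ B); apply: filterS2 xmax xB => z h1 h2.
  exact: le_trans (h1 i) h2.
move=> /forallNP unb; exfalso.
(* For an ultrafilter, not being bounded by B along G means exceeding B along G. *)
have {}unb B : G [set z | ~ (`|x z i0| <= B)].
  by have [/unb|] := in_ultra_setVsetC [set z | `|x z i0| <= B] GU.
have inv0 : (fun z => (x z i0)^-1) @ G --> (0 : C R).
  apply/cvgr0Pnorm_lt => e e0; apply: filterS (unb e^-1) => z /negP.
  rewrite -real_ltNge ?normr_real ?realV ?gtr0_real // => h.
  rewrite normfV invf_plt ?posrE //; apply: lt_trans h.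
  by rewrite invr_gt0.
have /choice[w hw] : forall i, exists l : C R,
    (fun z => x z i / x z i0) @ G --> l.
  move=> i1.
  apply: (@ultra_cvg_bounded _ 1); apply: filterS xmax => z /(_ i1) h /=.
  have [x0|x0] := eqVneq (x z i0) 0; first by rewrite x0 invr0 mulr0 normr0.
  by rewrite normrM normfV ler_pdivrMr ?normr_gt0 // mul1r.
have wi0 : w i0 = 1.
  apply: (cvg_field_unique _ (hw i0)).
  apply: cvg_near_cst; apply: filterS (unb 0) => z /= x0.
  by rewrite divff // -normr_le0; apply/negP.
have sum0 n j : (0 < n <= k + k)%N -> \sum_i m0 i j * w i ^+ n = 0.
  move=> hn; have n0 : n != 0%N by case: n hn.
  have h1 : (fun z => \sum_i m z i j * (x z i / x z i0) ^+ n) @ G -->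
      \sum_i m0 i j * w i ^+ n.
    apply: cvg_sumr => i1 _.
    exact: (cvgM (mm0 i1 j) (@cvg_exprn _ _ _ _ _ _ n (hw i1))).
  apply: (cvg_field_unique _ h1).
  (* The rescaled moment is a convergent moment times the n-th power of an inverse that tends to
     0. *)
  have -> : (fun z => \sum_i m z i j * (x z i / x z i0) ^+ n) =
      (fun z => (\sum_i m z i j * x z i ^+ n) * (x z i0)^-1 ^+ n).
    apply/funext => z; rewrite mulr_suml; apply: eq_bigr => i1 _.
    by rewrite exprMn mulrA.
  exact: (cvg_mul_expn0 n0 (xp n j hn) inv0).
have /(wm0 [set i | w i == 1]%SET)/eqP : [set i | w i == 1]%SET != finset.set0.
  by apply/set0Pn; exists i0; rewrite inE wi0.
apply; apply/rowP => j; rewrite summxE mxE.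
under eq_bigl do rewrite inE; under eq_bigr do rewrite mxE.
(* The comparison family keeps the weights and puts every point at 0: the moments of positive degree
   vanish on both sides, the zeroth ones agree, and no point of that family lies at 1. *)
rewrite (@eq_weight_of_moments _ k k _ _ (fun i => m0 i j) (fun=> 0)).
  by rewrite big_pred0 // => i1; rewrite eq_sym oner_eq0.
case=> [_|n nk]; first by apply: eq_bigr => i1 _; rewrite !expr0.
by rewrite sum0 // big1 // => i1 _; rewrite expr0n mulr0.
Qed.

End UltraLimits.

Lemma cvg_psum (K : numFieldType) (Z : Type) (F : set_system Z) k M
    (y : Z -> 'I_k -> K) (x : Z -> 'I_k -> K^o) (y0 : 'I_k -> K)
    (x0 : 'I_k -> K^o) :
  Filter F ->
  (forall n, (0 < n <= M)%N ->
     (fun z => e_pol n (y z) (x z) : K) @ F --> (e_pol n y0 x0 : K)) ->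
  forall n, (0 < n <= M)%N ->
     (fun z => psum n (y z) (x z) : K) @ F --> (psum n y0 x0 : K).
Proof.
move=> FF he; elim/ltn_ind => -[//|n] IH nM.
rewrite (psumS (@pchar_num _)); under eq_fun do rewrite (psumS (@pchar_num _)).
apply: cvgMl_tmp; apply: cvgB; first by apply: cvgMl_tmp; exact: he.
apply: cvg_sumr => j _; apply: cvgMl_tmp; apply: cvgM.
  apply: IH; first exact: (ltn_ord j).
  exact: (leq_trans (ltn_ord j) (ltnW nM)).
apply: he; rewrite subn_gt0 ltn_ord /=.
exact: leq_trans (leq_subr _ _) (ltnW nM).
Qed.

Section Properness.
Context (R : realType) (d k r N : nat) (X : set 'rV[C R]_d).
Hypotheses (hX : zariski_closed X) (hN : (k + k <= N)%N).
Local Notation emap := (@e_map R d k r N X).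

(** The image under [phi] of the component of [e_map] with index j and degree n; [e_scalE] makes
    this precise, with degree n + 1 stored at index n. *)
Definition e_scal (phi : 'I_d -> C R) (j : 'I_r) n (u : dom k r X) : C R :=
  e_pol n (fun l => set_val u.1 l j)
    (fun l => dot phi (set_val (u.2 l)) : (C R)^o).

Lemma e_scalE phi j n (nN : (n < N)%N) u : e_scal phi j n.+1 u =
  meval phi (mpoly_of_dhomog ((emap u).2 j (Ordinal nN))).
Proof. by symmetry; exact: meval_e_pol. Qed.

Lemma eq_e_scal phi j n u v : (0 < n <= N)%N -> emap u = emap v ->
  e_scal phi j n u = e_scal phi j n v.
Proof.
case: n => [h|n nN e]; first by case: (notF h).
rewrite (e_scalE phi j nN u) (e_scalE phi j nN v) e.
reflexivity.
Qed.

Lemma e_map_inj_sim u v : emap u = emap v -> sim u v.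
Proof.
move=> e; apply: sim_e_pol (congr1 fst e) _ => j phi n /andP[n0 nk].
by apply: (eq_e_scal phi j _ e); rewrite n0 (leq_trans nk).
Qed.

Section Limit.
Context (G : set_system (dom k r X)).

Lemma cvg_e_scal {GF : Filter G} (u : dom k r X) (j : 'I_r)
    (phi : 'I_d -> C R) n :
  (0 < n <= N)%N -> emap @ G --> emap u ->
  e_scal phi j n @ G --> e_scal phi j n u.
Proof.
case: n => [//|n] /= nN eu.
have h1 : (fun v => (emap v).2) @ G --> (emap u).2.
  exact: (cvg_comp _ _ eu cvg_snd).
have h2 : (fun v => (emap v).2 j) @ G --> (emap u).2 j.
  exact: (cvg_comp _ _ h1 (@proj_continuous _
    (fun=> prod_topology (fun i : 'I_N => Sym R d i.+1)) j _)).
have h3 : (fun v => (emap v).2 j (Ordinal nN)) @ G -->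
    (emap u).2 j (Ordinal nN).
  exact: (cvg_comp _ _ h2 (@proj_continuous _
    (fun i : 'I_N => Sym R d i.+1) (Ordinal nN) _)).
rewrite (e_scalE phi j nN); have -> : e_scal phi j n.+1 = fun v =>
    meval phi (mpoly_of_dhomog ((emap v).2 j (Ordinal nN))).
  by apply/funext => v; exact: e_scalE.
exact: cvg_meval_homog h3.
Qed.

(** The weights converge as part of [e_map], and each coordinate of the points converges by
    [ultra_cvg_of_moments]. By continuity of [e_map] and uniqueness of limits, the limit has the
    same scalars [e_scal] as u, hence is equivalent to u. *)
Lemma ultra_cvg_dom {GU : UltraFilter G} (u : dom k r X) :
  emap @ G --> emap u ->
  exists u' : dom k r X, G --> u' /\ sim u' u.
Proof.
move=> eu; have GF : Filter G by exact: _.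
have w1 i j : (fun v : dom k r X => set_val v.1 i j) @ G --> set_val u.1 i j.
  have h1 : (fun v : dom k r X => (emap v).1) @ G --> (emap u).1.
    exact: (cvg_comp _ _ eu cvg_fst).
  have h2 := cvg_comp _ _ h1 (@initial_continuous _ _ set_val u.1).
  exact: (cvg_comp _ _ h2 (@coord_mx_continuous _ _ _ i j (set_val u.1))).
have coord i c : exists l : C R,
    (fun v : dom k r X => set_val (v.2 i) 0 c) @ G --> l.
  (* The coordinate c is itself a linear form, so its moments are governed by [e_scal]. *)
  pose phi c' : C R := (c' == c)%:R.
  have dotE v : dot phi v = v 0 c.
    rewrite /dot (bigD1 c) //= /phi eqxx mulr1 big1 ?addr0 // => c' /negPf ->.
    by rewrite mulr0.
  apply: (@ultra_cvg_of_moments R _ G _ k r (fun v : dom k r X => set_val v.1)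
    (set_val u.1)
    (fun v l => set_val (v.2 l) 0 c)
    (fun n j => \sum_l set_val u.1 l j * set_val (u.2 l) 0 c ^+ n)) => //.
    exact: (set_valP u.1).
  move=> n j /andP[n0 nk].
  have hn : (0 < n <= N)%N by rewrite n0 (leq_trans nk).
  have h := @cvg_psum (C R) _ G k N (fun v l => set_val v.1 l j)
    (fun v l => dot phi (set_val (v.2 l))) _ _ GF
    (fun m hm => @cvg_e_scal GF u j phi m hm eu) n hn.
  have E (v : dom k r X) : \sum_l set_val v.1 l j * set_val (v.2 l) 0 c ^+ n =
      psum n (fun l => set_val v.1 l j)
        (fun l => dot phi (set_val (v.2 l)) : (C R)^o).
    by rewrite /psum; apply: eq_bigr => l _; rewrite dotE.
  by rewrite E; under eq_fun do rewrite E.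
have /choice[L hL] : forall i, exists l : 'I_d -> C R,
    forall c, (fun v : dom k r X => set_val (v.2 i) 0 c) @ G --> l c.
  by move=> i; have /choice[l hl] := coord i; exists l.
pose w i : 'rV[C R]_d := \row_c L i c.
have hw i c : (fun v : dom k r X => set_val (v.2 i) 0 c) @ G --> w i 0 c.
  by rewrite mxE; exact: hL.
(* X is closed: a polynomial of the defining set vanishes along G, hence also at the limit. *)
have wX i : X (w i).
  have [I eX] := hX.
  have XI y : X y -> forall p, I p -> meval (fun c => y 0 c) p = 0.
    by rewrite [in X in X -> _]eX.
  rewrite eX => p Ip.
  pose f (v : dom k r X) : C R := meval (fun c => set_val (v.2 i) 0 c) p.
  have h : f @ G --> (meval (fun c => w i 0 c) p : C R).
    exact: cvg_meval_coord (hw i).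
  have h0 : f @ G --> (0 : C R).
    apply: cvg_near_cst; apply: nearW => v.
    exact: XI (set_valP (v.2 i)) _ Ip.
  exact: (cvg_field_unique _ h h0).
have [u' [u1 u2]] : exists u' : dom k r X,
    u'.1 = u.1 /\ forall i, set_val (u'.2 i) = w i.
  by exists (u.1, fun i => SigSub (mem_set (wX i))).
have Gu' : G --> u'.
  apply: (@cvg_dom R d k r X _ G id u' GF) => i j.
    by rewrite u1; exact: w1.
  by rewrite u2; exact: hw.
exists u'; split; first exact: Gu'.
apply: sim_e_pol u1 _ => j phi n /andP[n0 nk].
have hn : (0 < n <= N)%N by rewrite n0 (leq_trans nk).
have eu' : emap @ G --> emap u'.
  exact: (cvg_comp _ _ Gu' (@e_map_continuous _ _ _ _ _ _ u')).
exact: (cvg_field_unique _ (@cvg_e_scal GF u' j phi n hn eu')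
                           (@cvg_e_scal GF u j phi n hn eu)).
Qed.
End Limit.

Lemma near_e_map (u : dom k r X) (U : set (dom k r X)) :
  open U -> (forall v w, sim v w -> U v -> U w) -> U u ->
  exists2 V, nbhs (emap u) V & emap @^-1` V `<=` U.
Proof.
move=> oU sU Uu; apply: contrapT => no.
pose F := filter_from (nbhs (emap u)) (fun V => emap @^-1` V `&` ~` U).
have FF : ProperFilter F.
  apply: filter_from_proper.
    apply: filter_from_filter; first by exists setT; exact: filterT.
    move=> V W hV hW; exists (V `&` W); first exact: filterI.
    by move=> v [[Vv Wv] Uv].
  move=> V hV; apply: contrapT => e; apply: no; exists V => // v Vv.
  by apply: contrapT => nU; apply: e; exists v.
have [G [GU FG]] := ultraFilterLemma FF.
have eG : emap @ G --> emap u.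
  by move=> V hV; apply: FG; exists V => // v [].
have [u' [Gu' su']] := ultra_cvg_dom eG.
have GU' : G U.
  apply: Gu'; apply: open_nbhs_nbhs; split => //.
  by apply: sU Uu; rewrite sim_sym.
have GnU : G (~` U) by apply: FG; exists setT; [exact: filterT|move=> v []].
have GE : G (U `&` ~` U) by exact: filterI.
by have [v []] := filter_ex GE.
Qed.
End Properness.

(** * The homeomorphism with the quotient *)

Theorem proposition4p1 (R : realType) (d k r : nat) (X : set 'rV[C R]_d) :
  zariski_closed X -> (0 < k)%N -> (0 < r)%N ->
  exists N0 : nat, forall N : nat, (N0 <= N)%N ->
    exists f : wconf k r X -> Delta k r N X,
      (forall u : dom k r X, f (\pi_(wconf k r X) u) = to_Delta N u) /\
      homeomorphism f.
Proof.
(* Telling apart two families of k points takes the moments up to degree k + k. *)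
move=> hX _ _; exists (k + k)%N => N hN.
have piP (u v : dom k r X) :
    \pi_(wconf k r X) u = \pi_(wconf k r X) v <-> sim u v.
  by split=> [/eqmodP|h]; last exact/eqmodP.
pose f (x : wconf k r X) : Delta k r N X := to_Delta N (repr x).
have fpi u : f (\pi_(wconf k r X) u) = to_Delta N u.
  by apply: val_inj; apply: e_map_sim; apply/piP; rewrite reprK.
have ex (y : Delta k r N X) : exists u : dom k r X, e_map N u = set_val y.
  by have [u _ uy] := set_valP y; exists u.
(* A preimage chosen arbitrarily: [h] need not be continuous, only its class modulo [sim] will
   be. *)
pose h y : dom k r X := sval (cid (ex y)).
have hE y : e_map N (h y) = set_val y := svalP (cid (ex y)).
exists f; split => //; split.
  apply/quotient_continuous => u.
  have -> : f \o \pi_(wconf k r X) = @to_Delta R d k r N X.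
    by apply/funext.
  by apply: cvg_set_val; exact: e_map_continuous.
exists (fun y => \pi_(wconf k r X) (h y)); split.
- move=> y A; rewrite nbhsE => -[B [oB By] BA].
  (* The preimage of [B] in [dom] is open and saturated, as [near_e_map] requires. *)
  have oU : open [set v : dom k r X | B (\pi_(wconf k r X) v)].
    have := @pi_continuous (dom k r X) {eq_quot (@sim R d k r X)}.
    by move/continuousP; apply.
  have [] := near_e_map hX hN (u := h y) oU _ By.
    by move=> v w /piP vw /=; rewrite vw.
  move=> V hV VU; have yV : nbhs y (set_val @^-1` V).
    by apply: (@initial_continuous _ _ set_val y); rewrite /= -hE.
  apply: (@filterS _ (nbhs y) _ _ _ _ yV) => z Vz; apply: BA.
  by apply: (VU (h z)); rewrite /preimage /= hE.
- move=> x; rewrite -(reprK x) fpi; apply/piP; apply: (e_map_inj_sim hN).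
  exact: hE.
- by move=> y; rewrite fpi; apply: val_inj; exact: hE.
Qed.
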